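(* Let $X$ be a $q$-homogeneous tree with $q\ge 2$ and origin $o$, and let $\sigma$ be a reference measure on $X$. Let $z\in X$ and let $[o,z]=\{v_t\}_{t=0}^{|z|}$ be the path from $v_0=o$ to $v_{|z|}=z$. The reproducing kernel functions of $\mathcal{A}^2(\sigma)$ satisfy $$K_z=\begin{cases}\dfrac1{B_\sigma},&\text{if } z=o,\\[2mm] K_o+\dfrac1{b_0}\big(\Gamma(o,z,\cdot)\big)^H_0,&\text{if }|z|=1,\\[2mm] -\dfrac1qK_{v_{m-2}}+\dfrac{q+1}{q}K_{v_{m-1}}+\dfrac1{b_{m-1}}\big(\Gamma(v_{m-1},z,\cdot)\big)^H_{m-1},&\text{if }|z|=m>1.\end{cases}$$
   Context: A $q$-homogeneous tree $X$ ($q\ge 2$ an integer) is an undirected connected cycle-free graph in which every vertex has exactly $q+1$ neighbours; $X$ also denotes its vertex set, $d$ is the graph distance, $u\sim v$ means adjacency, $o\in X$ is a fixed origin and $|x|=d(o,x)$; $B(o,n)=\{x:|x|\le n\}$. $[o,x]$ is the unique path from $o$ to $x$. The sector of $v\neq o$ is $T_v=\{x\in X:[o,v]\subseteq[o,x]\}$, and $T_o=X$. For $x\ne o$, the predecessor $p(x)$ is the unique neighbour of $x$ with $|p(x)|=|x|-1$; $p^\ell$ is the $\ell$-fold iterate, $p^0=\mathrm{id}$. The set of successors of $v$ is $s(v)=\{u\sim v:|u|=|v|+1\}$. A function $f:X\to\mathbb{C}$ is harmonic on $Y\subseteq X$ if $f(v)=\frac1{q+1}\sum_{u\sim v}f(u)$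 for every $v\in Y$, and harmonic if it is harmonic on $X$. A reference measure on $X$ is a finite measure which is absolutely continuous with respect to the counting measure, with density (also denoted $\sigma$) a strictly positive, radial (depending only on $|x|$) function that is decreasing in $|x|$; $\sigma_n$ is the value of $\sigma$ on $\{|x|=n\}$ and $B_\sigma=\sum_{x\in X}\sigma(x)$. $\mathcal{A}^2(\sigma)$ is the Hilbert space of harmonic functions $f$ with $\sum_x|f(x)|^2\sigma(x)<\infty$, with scalar product $\langle f,g\rangle_{\mathcal{A}^2(\sigma)}=\sum_{x}f(x)\overline{g(x)}\sigma(x)$; it is a reproducing kernel Hilbert space and $K_z\in\mathcal{A}^2(\sigma)$ is the unique element with $\langle g,K_z\rangle_{\mathcal{A}^2(\sigma)}=g(z)$ for all $g\in\mathcal{A}^2(\sigma)$. Put $a_n=\sum_{j=0}^nq^{-j}$ for $n\in\mathbb{N}=\{0,1,2,\dots\}$, $a_{-1}=0$, and $$b_n=\sum_{m=n+1}^\infty\sigma_m\,a_{m-n-1}\Big(\sum_{k=0}^{m-n-1}q^k\Big).$$ If $g$ is harmonic on $B(o,n)$, its harmonic extension $g^H_n$ is the harmonic function on $X$ $$g^H_n(x)=\begin{cases}g(x),&|x|\le n,\\ a_{|x|-n-1}\,g(p^{|x|-n-1}(x))-(a_{|x|-n-1}-1)\,g(p^{|x|-n}(x)),&|x|>n.\end{cases}$$ For $(v,z,x)\in X^3$: $\Gamma(v,z,x)=0$ if $\{z,x\}\not\subseteq T_v\setminus\{v\}$; $\Gamma(v,z,x)=\frac{\# s(v)-1}{\#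 s(v)}$ if $\{z,x\}\subseteq T_y$ for some $y\in s(v)$; $\Gamma(v,z,x)=-\frac1{\# s(v)}$ otherwise. The function $\Gamma(v,z,\cdot)$ is harmonic on $B(o,|v|)$. *)

(* Defs.v *)
From HB Require Import structures.
From mathcomp Require Import all_boot all_order all_algebra.
From mathcomp Require Import finmap all_classical all_reals.
From mathcomp Require Import ereal sequences esum numfun.
From mathcomp Require Import complex.

Set Implicit Arguments.
Unset Strict Implicit.
Unset Printing Implicit Defensive.

Import Order.TTheory GRing.Theory Num.Theory.
Local Open Scope classical_set_scope.
Local Open Scope card_scope.
Local Open Scope ring_scope.

(* [ucycle] also counts two-element "cycles" x ~ y ~ x, which every edge
   yields; a genuine cycle has at least three vertices. *)
Record homogeneousTree (q : nat) := HomogeneousTree {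
  vertex :> choiceType;
  adj : rel vertex;
  adj_sym : symmetric adj;
  adj_irr : irreflexive adj;
  adj_connected : forall x y : vertex,
    exists2 p : seq vertex, path adj x p & last x p = y;
  adj_acyclic : forall c : seq vertex, ucycle adj c -> (size c < 3)%N;
  adj_regular : forall v : vertex, [set u | adj v u] #= `I_q.+1 }.

Section Tree.
Variables (q : nat) (X : homogeneousTree q).

Definition neighbours (v : X) : set X := [set u | adj v u].

Definition dist (x y : X) : nat :=
  xget 0%N [set n | (exists p, [/\ path (@adj q X) x p, last x p = y & size p = n])
    /\ (forall p, path (@adj q X) x p -> last x p = y -> (n <= size p)%N)].

(* The path [x, y], as the list of its vertices starting at x. *)
Definition geodesic (x y : X) : seq X :=
  xget [::] [set s | exists p,
    [/\ s = x :: p, path (@adj q X) x p, uniq s & last x p = y]].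

Variable o : X.

Definition height (x : X) : nat := dist o x.

Definition sphere (n : nat) : set X := [set x | height x = n].

Definition sector (v : X) : set X :=
  if v == o then setT
  else [set x | {subset geodesic o v <= geodesic o x}].

(* Meaningful for x != o only; the value at o is a dummy. *)
Definition predecessor (x : X) : X :=
  xget o [set u | adj x u /\ (height u).+1 = height x].

Definition successors (v : X) : set X :=
  [set u | adj v u /\ height u = (height v).+1].

Definition num_successors (v : X) : nat := #|` fset_set (successors v)|.

End Tree.

Section Analysis.
Variables (R : realType) (q : nat) (X : homogeneousTree q).

Definition harmonic_on (Y : set X) (f : X -> R[i]) : Prop :=
  forall v, Y v -> f v = q.+1%:R^-1 * \sum_(u \in neighbours v) f u.

Definition harmonic_fun (f : X -> R[i]) : Prop := harmonic_on setT f.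

(* Sums of absolutely summable families indexed by X, i.e. integrals with
   respect to the counting measure. *)
Definition rsum (F : X -> R) : R :=
  fine (\esum_(x in [set: X]) ((EFin \o F)^\+ x)
      - \esum_(x in [set: X]) ((EFin \o F)^\- x))%E.

Definition csum (F : X -> R[i]) : R[i] :=
  Complex (rsum (fun x => complex.Re (F x))) (rsum (fun x => complex.Im (F x))).

Variable o : X.

(* A reference measure is represented by its density with respect to the
   counting measure. *)
Record reference_measure (sigma : X -> R) : Prop := ReferenceMeasure {
  refm_gt0 : forall x, 0 < sigma x;
  refm_radial : forall x y, height o x = height o y -> sigma x = sigma y;
  refm_decr : forall x y, (height o x <= height o y)%N -> sigma y <= sigma x;
  refm_finite : (\esum_(x in [set: X]) (sigma x)%:E < +oo)%E }.

Variable sigma : X -> R.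

Definition sigma_at (n : nat) : R := sigma (xget o (sphere o n)).

Definition B_sigma : R := fine (\esum_(x in [set: X]) (sigma x)%:E).

Definition A2 : set (X -> R[i]) :=
  [set f | harmonic_fun f
    /\ (\esum_(x in [set: X]) (ComplexField.Normc.normc (f x) ^+ 2 * sigma x)%:E < +oo)%E].

Definition A2_dot (f g : X -> R[i]) : R[i] :=
  csum (fun x => f x * (g x)^* * (sigma x)%:C%C).

Definition repr_kernel (z : X) : X -> R[i] :=
  xget (fun=> 0) [set k | A2 k /\ forall g, A2 g -> A2_dot g k = g z].

Definition a_coef (n : nat) : R := \sum_(0 <= j < n.+1) q%:R ^- j.

Definition b_coef (n : nat) : R :=
  fine (\sum_(n.+1 <= m <oo)
    (sigma_at m * a_coef (m - n - 1) *
     \sum_(0 <= k < (m - n - 1).+1) q%:R ^+ k)%:E)%E.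

Definition harmonic_extension (n : nat) (g : X -> R[i]) (x : X) : R[i] :=
  let p l := iter l (predecessor o) x in
  if (height o x <= n)%N then g x
  else (a_coef (height o x - n - 1))%:C%C * g (p (height o x - n - 1)%N)
       - (a_coef (height o x - n - 1) - 1)%:C%C * g (p (height o x - n)%N).

Definition Gamma (v z x : X) : R[i] :=
  let s := num_successors o v in
  if ~~ `[< [set z; x] `<=` sector o v `\ v >] then 0
  else if `[< exists2 y, successors o v y & [set z; x] `<=` sector o y >]
  then (s%:R - 1) / s%:R
  else - s%:R^-1.

End Analysis.

(* Main.v *)
Require Import Defs.
From mathcomp Require Import all_boot all_order all_algebra.
From mathcomp Require Import finmap all_classical all_reals.
From mathcomp Require Import topology normedtype ereal sequences esum numfun.
From mathcomp Require Import complex ring lra.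

(** Integrating a harmonic function h against the harmonic extension G of
    sphere data gam amounts to pairing h with gam on a single sphere.  Let
    gam live on the sphere of radius n + 1 and sum to zero over the successors
    of each vertex of height n, and let G vanish on the ball of radius n.
    Below a vertex y of height n + 1, G is constant on each generation,
      while the
    sum of h over the j-th generation below y is
      q^j (a_j h(y) - (a_j - 1) h(p(y)))    ([sum_descendants]).
    The terms in h(p(y)) cancel against the zero sums of gam, and summing over
    j gives <h, G> = b_n * sum_y h(y) gam(y)   ([represents_radial_lift]).

    For gam = Gamma(p(z), z, .) the right-hand side is b_n times h(z) minus the
    mean of h over the successors of p(z), and harmonicity at p(z) expresses
    that mean by h(p(z)) and h(p(p(z))).  Hence the right-hand side of each
    recursion reproduces evaluation at z as soon as the kernels occurring in
    it reproduce their own evaluations.  The constant 1 / B_sigma reproduces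
    evaluation at o because a harmonic function has mean h(o) on every sphere
    ([sum_sphere]), so induction on the height of z produces a reproducing
    function for every vertex ([represents_exists]).

    These functions are real and bounded.  Boundedness makes all pairings
    absolutely convergent, hence limits of sums over balls ([rsum_cvg]); being
    real, they can be tested separately on the real and imaginary parts of an
    element of A^2(sigma).  The difference between a reproducing element and
    one of them is orthogonal to itself, hence zero, which identifies it with
    the kernel chosen by [repr_kernel] ([repr_kernelE]). *)

Set Implicit Arguments.
Unset Strict Implicit.
Unset Printing Implicit Defensive.

Import Order.TTheory GRing.Theory Num.Theory.
Import numFieldNormedType.Exports.
Local Open Scope classical_set_scope.
Local Open Scope ring_scope.

(** * The rooted tree *)

Section RootedTree.
Variables (q : nat) (X : homogeneousTree q).
Notation adj := (@adj q X).

(** If two simple paths with the same endpoints part at x, follow the first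
    one until it meets the second again at w and return to x along the second:
    this is a simple cycle with at least three vertices. *)
Lemma simple_path_unique (x : X) (p p' : seq X) :
  path adj x p -> path adj x p' -> uniq (x :: p) -> uniq (x :: p') ->
  last x p = last x p' -> p = p'.
Proof.
elim: p x p' => [|a r IHr] x [|b r'] //.
- move=> _ _ _ /= /andP[xr _] eqx; by rewrite eqx mem_last in xr.
- by move=> _ _ /= /andP[xr _] _ /= eqx; rewrite -eqx mem_last in xr.
case: (a =P b) => [<-|neq_ab].
  move=> /= /andP[_ ar] /andP[_ ar'] /andP[_ ur] /andP[_ ur'] eql.
  by rewrite (IHr a r').
move: (a :: r) (b :: r') (erefl : ohead (a :: r) = Some a)
  (erefl : ohead (b :: r') = Some b).
move=> p p' /= hp hp' pth pth' /andP[xp up] /andP[xp' up'] eql.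
(* The common endpoint shows that the first path meets the second after x. *)
have hasp : has (mem p') p.
  apply/hasP; exists (last x p).
    by case: (p) hp => //= c s _; exact: mem_last.
  by rewrite eql; case: (p') hp' => //= c s _; exact: mem_last.
exfalso; move: hp pth xp up {eql}.
case: (split_find hasp) => w p1 p2 wp' p1p' hp pth xp up.
move: hp' pth' xp' up' p1p'.
case/path.splitP: wp' => p1' p2' hp' pth' xp' up' p1p'.
have pw : path adj w (rcons (rev p1') x).
  move: pth'; rewrite cat_path => /andP[pth' _].
  have := rev_path adj x (rcons p1' w).
  rewrite last_rcons belast_rcons rev_cons => ->.
  by rewrite (eq_path (e' := adj)) // => y y'; exact: adj_sym.
have cyc : ucycle adj (x :: rcons p1 w ++ rev p1').
  rewrite /ucycle /cycle rcons_cat cat_path last_rcons pw andbT.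
  move: pth; rewrite cat_path => /andP[-> _] /=.
  rewrite !mem_cat !negb_or mem_rev in xp xp' *.
  case/andP: xp => -> _; case/andP: xp'; rewrite mem_rcons inE negb_or.
  case/andP=> _ -> _ /=.
  rewrite !cat_uniq rev_uniq in up up' *.
  case/and3P: up => -> _ _; case/and3P: up' => + _ _.
  rewrite rcons_uniq => /andP[wp1' ->]; rewrite andbT /=.
  apply/hasPn => y; rewrite mem_rev => yp1' /=.
  rewrite mem_rcons inE negb_or; apply/andP; split.
    by apply: contraNneq wp1' => <-.
  apply: contraNN p1p' => yp1; apply/hasP; exists y => //=.
  by rewrite mem_cat mem_rcons inE yp1' orbT.
have := adj_acyclic cyc; rewrite /= size_cat size_rcons size_rev.
case: p1 hp {cyc pth xp up p1p'} => //= -[wa].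
case: p1' hp' {pw pth' xp' up'} => //= -[wb].
by case: neq_ab; rewrite -wa -wb.
Qed.

Lemma simple_path_exists (x y : X) :
  exists p, [/\ path adj x p, uniq (x :: p) & last x p = y].
Proof.
have [p pth <-] := adj_connected x y.
by case: (shortenP pth) => p' pth' up' _; exists p'.
Qed.

Lemma geodesic_simple (x : X) p :
  path adj x p -> uniq (x :: p) -> geodesic x (last x p) = x :: p.
Proof.
move=> pth up; apply: xget_unique; first by exists p.
move=> _ [p' [-> pth' up' eql]].
by rewrite (simple_path_unique pth pth' up up' (esym eql)).
Qed.

Lemma dist_simple (x : X) p :
  path adj x p -> uniq (x :: p) -> dist x (last x p) = size p.
Proof.
move=> pth up; apply: xget_unique => [|n [[p' [pth' eql <-]] minp']];
  last first.
  have := minp' p pth erefl.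
  case: (shortenP pth') eql => p1 pth1 up1 sub1 eql.
  rewrite -(simple_path_unique pth1 pth up1 up eql) => le1.
  apply/eqP; rewrite eqn_leq le1 /=.
  by apply: uniq_leq_size; [case/andP: up1 | exact: sub1].
split; first by exists p.
move=> p' pth' eql; case: (shortenP pth') eql => p1 pth1 up1 sub1 eql.
rewrite -(simple_path_unique pth1 pth up1 up eql).
by apply: uniq_leq_size; [case/andP: up1 | exact: sub1].
Qed.

Variable o : X.
Notation height := (height o).
Notation pred := (predecessor o).
Notation geo := (geodesic o).

Lemma height_geodesic x : (height x).+1 = size (geo x).
Proof.
have [p [pth up <-]] := simple_path_exists o x.
by rewrite /Defs.height dist_simple // geodesic_simple.
Qed.

Lemma geodesic_origin : geo o = [:: o].
Proof. exact: (@geodesic_simple o [::]). Qed.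

Lemma last_geodesic x : last o (geo x) = x.
Proof.
have [p [pth up <-]] := simple_path_exists o x.
by rewrite geodesic_simple.
Qed.

Lemma height_origin : height o = 0%N.
Proof. by apply/eqP; rewrite -eqSS height_geodesic geodesic_origin. Qed.

Lemma height_eq0 x : (height x == 0%N) = (x == o).
Proof.
apply/eqP/eqP => [hx|->]; last exact: height_origin.
have := height_geodesic x; have := last_geodesic x; rewrite hx.
have [p [pth up <-]] := simple_path_exists o x.
by rewrite geodesic_simple //; case: p {pth up hx}.
Qed.

(** A neighbour x of u either prolongs the simple path from o to u or lies on
    it; in the second case the part of the path up to x is the geodesic of x,
    and adding the edge back to u must give the whole path. *)
Lemma adj_geodesic u x : adj u x ->
  geo x = rcons (geo u) x \/ geo u = rcons (geo x) u.
Proof.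
have [p [pth up lastu]] := simple_path_exists o u.
move=> ux; have geou : geo u = o :: p by rewrite -lastu geodesic_simple.
have [xp|xp] := boolP (x \in o :: p); last first.
  left; rewrite geou -[X in geo X](last_rcons o p x) geodesic_simple //.
    by rewrite rcons_path pth lastu.
  by rewrite -rcons_cons rcons_uniq xp up.
right; case/splitPl: xp pth up lastu geou => p1 p2 lastx pth up lastu geou.
move: pth up; rewrite cat_path => /andP[pth1 _].
rewrite -cat_cons cat_uniq => /and3P[up1 dis _].
have -> : geo x = o :: p1 by rewrite -lastx geodesic_simple.
rewrite -[X in geo X](last_rcons o p1 u) geodesic_simple //.
  by rewrite rcons_path pth1 lastx adj_sym.
rewrite -rcons_cons rcons_uniq up1 andbT.
apply: contraNN dis => up1'; apply/hasP; exists u => //.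
case: p2 lastu {geou} => [|c p2].
  rewrite cats0 => eqxu; move: ux.
  by rewrite -lastx -eqxu adj_irr.
by rewrite last_cat /= => <-; exact: mem_last.
Qed.

Lemma adj_height_eqS u x : adj u x ->
  (height x).+1 = height u -> geo u = rcons (geo x) u.
Proof.
move=> /adj_geodesic[] // e hx.
have := congr1 size e; rewrite size_rcons -!height_geodesic -hx => /eqP.
rewrite !eqSS => /eqP h.
by have := leqnSn (height x).+1; rewrite -h ltnn.
Qed.

Lemma predecessor_uniq u x : adj u x -> (height x).+1 = height u -> pred u = x.
Proof.
move=> ux hx; apply: xget_unique; first by [].
move=> y [uy hy]; have := adj_height_eqS ux hx.
rewrite (adj_height_eqS uy hy) => /rcons_inj[e].
by rewrite -(last_geodesic y) e last_geodesic.
Qed.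

Lemma adj_predecessor x : x != o ->
  adj x (pred x) /\ (height (pred x)).+1 = height x.
Proof.
move=> xo; suff: exists y, adj x y /\ (height y).+1 = height x.
  exact: (@xgetPex X o [set u | adj x u /\ (height u).+1 = height x]).
have [p [pth up lastx]] := simple_path_exists o x.
case/lastP: p pth up lastx => [|p y] pth up lastx.
  by move: lastx xo => /= ->; rewrite eqxx.
rewrite last_rcons in lastx; subst y.
move: pth; rewrite rcons_path => /andP[pth px].
exists (last o p); split; first by rewrite adj_sym.
rewrite /Defs.height -(last_rcons o p x) !dist_simple ?size_rcons //.
- by rewrite rcons_path pth.
- by move: up; rewrite -rcons_cons rcons_uniq => /andP[].
Qed.

Lemma height_predecessor x : x != o -> (height (pred x)).+1 = height x.
Proof. by case/adj_predecessor. Qed.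

Lemma geodesic_predecessor x : x != o -> geo x = rcons (geo (pred x)) x.
Proof. by case/adj_predecessor => ? ?; exact: adj_height_eqS. Qed.

Lemma adj_parent u x : adj u x -> pred u = x /\ u != o \/ pred x = u /\ x != o.
Proof.
have neq_o y : (0 < height y)%N -> y != o by rewrite lt0n height_eq0.
move=> ux; case: (adj_geodesic ux) => e; [right | left].
  have hx : (height u).+1 = height x.
    by apply/eqP; rewrite -eqSS !height_geodesic e size_rcons.
  by split; [apply: predecessor_uniq; rewrite 1?adj_sym | apply: neq_o;
    rewrite -hx].
have hu : (height x).+1 = height u.
  by apply/eqP; rewrite -eqSS !height_geodesic e size_rcons.
by split; [exact: predecessor_uniq | apply: neq_o; rewrite -hu].
Qed.

(** A list rather than a set, so that big operators range over it and the
    generations below a vertex arise by concatenation. *)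
Definition children (v : X) : seq X := fset_set (successors o v).

Lemma finite_neighbours (v : X) : finite_set (neighbours v).
Proof. by apply/finite_setP; exists q.+1; exact: adj_regular. Qed.

Lemma finite_successors v : finite_set (successors o v).
Proof. by apply: sub_finite_set (finite_neighbours v) => u []. Qed.

Lemma successorsP u v : successors o v u <-> u != o /\ pred u = v.
Proof.
split=> [[vu hu]|[uo <-]].
  split; first by rewrite -height_eq0 hu.
  by apply: predecessor_uniq; rewrite 1?adj_sym.
have [upu hpu] := adj_predecessor uo.
by split; [rewrite /= adj_sym | rewrite hpu].
Qed.

Lemma childrenP u v : reflect (successors o v u) (u \in children v).
Proof.
by rewrite /children in_fset_set ?inE; [exact: asboolP | exact:
  finite_successors].
Qed.

Lemma mem_children u v : (u \in children v) = (u != o) && (pred u == v).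
Proof.
apply/childrenP/andP; rewrite successorsP; first by case=> ? /eqP.
by case=> ? /eqP.
Qed.

Lemma uniq_children v : uniq (children v).
Proof. exact: fset_uniq. Qed.

Lemma height_children u v : u \in children v -> height u = (height v).+1.
Proof. by case/childrenP. Qed.

Lemma size_neighbours (v : X) : size (fset_set (neighbours v)) = q.+1.
Proof. by apply: (card_fset_set (n := q.+1)); exact: adj_regular. Qed.

Lemma mem_neighbours (u v : X) : (u \in fset_set (neighbours v)) = adj v u.
Proof. by rewrite in_fset_set ?inE; [exact: asboolb | exact: finite_neighbours].
  Qed.

Lemma neighbours_origin : perm_eq (fset_set (neighbours o)) (children o).
Proof.
apply: uniq_perm; rewrite ?fset_uniq //= => u.
rewrite mem_neighbours mem_children.
apply/idP/andP => [/adj_parent[[_]|[-> ->]] | [uo /eqP <-]]; rewrite ?eqxx //.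
by rewrite adj_sym; case: (adj_predecessor uo).
Qed.

(** Away from the origin a vertex has one neighbour closer to o, its
    predecessor, and all others are successors; this is how harmonicity becomes
    a recursion along the tree. *)
Lemma neighbours_children v : v != o ->
  perm_eq (fset_set (neighbours v)) (pred v :: children v).
Proof.
move=> vo; apply: uniq_perm; rewrite ?fset_uniq //= ?uniq_children ?andbT.
  apply/negP => /height_children; rewrite -(height_predecessor vo) => h.
  by have := leqnSn (height (pred v)).+1; rewrite -h ltnn.
move=> u; rewrite mem_neighbours inE mem_children.
apply/idP/orP => [/adj_parent[[-> _]|[-> ->]]|]; rewrite ?eqxx; auto.
case=> [/eqP ->|/andP[uo /eqP <-]]; first by case: (adj_predecessor vo).
by rewrite adj_sym; case: (adj_predecessor uo).
Qed.

Lemma size_children v : size (children v) = (q + (v == o))%N.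
Proof.
have := size_neighbours v; case: eqVneq => [->|vo].
  by rewrite (perm_size neighbours_origin) addn1.
by rewrite (perm_size (neighbours_children vo)) addn0 => -[].
Qed.

Fixpoint descendants (y : X) (j : nat) : seq X :=
  if j is i.+1 then flatten [seq children w | w <- descendants y i] else [:: y].

Lemma mem_descendantsS x y j : (x \in descendants y j.+1) =
  (x != o) && (pred x \in descendants y j).
Proof.
apply/flatten_mapP/andP => [[w wy]|[xo px]].
  by rewrite mem_children => /andP[-> /eqP ->].
by exists (pred x) => //; rewrite mem_children xo eqxx.
Qed.

Lemma uniq_descendants y j : uniq (descendants y j).
Proof.
elim: j => //= j IHj.
have -> : flatten [seq children w | w <- descendants y j] =
    [seq u | w <- descendants y j, u <- children w].
  by congr flatten; apply: eq_map => w; rewrite map_id.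
apply: allpairs_uniq_dep => // [w _|]; first exact: uniq_children.
move=> _ _ /allpairsPdep[w [u [_ uw ->]]] /allpairsPdep[w' [u' [_ uw' ->]]] /=
  eu.
rewrite -eu {u' eu} in uw' *; congr (existT _ _ _).
by move: uw uw'; rewrite !mem_children => /andP[_ /eqP <-] /andP[_ /eqP].
Qed.

Lemma descendantsP x y j : x \in descendants y j ->
  height x = (height y + j)%N /\ iter j pred x = y.
Proof.
elim: j x => [|j IHj] x; first by rewrite inE addn0 => /eqP->.
rewrite mem_descendantsS => /andP[xo /IHj[hx itx]].
by rewrite -(height_predecessor xo) hx addnS iterSr.
Qed.

Lemma mem_sphere x k : (x \in descendants o k) = (height x == k).
Proof.
elim: k x => [|k IHk] x; first by rewrite inE height_eq0.
rewrite mem_descendantsS IHk; case: eqVneq => [->|xo].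
  by rewrite height_origin.
by rewrite -(height_predecessor xo) eqSS.
Qed.

Lemma sum_descendantsS (V : nmodType) (F : X -> V) y j :
  \sum_(x <- descendants y j.+1) F x =
  \sum_(w <- descendants y j) \sum_(x <- children w) F x.
Proof. by rewrite big_flatten big_map. Qed.

Lemma sum_descendantsD (V : nmodType) (F : X -> V) y i j :
  \sum_(x <- descendants y (i + j)) F x =
  \sum_(w <- descendants y i) \sum_(x <- descendants w j) F x.
Proof.
elim: j F => [|j IHj] F.
  by rewrite addn0; apply: eq_bigr => w _; rewrite big_seq1.
rewrite addnS sum_descendantsS IHj; apply: eq_bigr => w _.
by rewrite sum_descendantsS.
Qed.

End RootedTree.

(** * Harmonic functions on spheres and sectors *)

Section HarmonicSums.
Variables (R : realType) (q : nat) (X : homogeneousTree q) (o : X).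
Hypothesis q_gt1 : (1 < q)%N.
Notation height := (height o).
Notation pred := (predecessor o).
Notation children := (children o).
Notation descendants := (descendants o).
Implicit Types (h g : X -> R) (v w x y : X).

(** The mean value property for real functions, multiplied by q + 1 so that
    the recursions along the tree involve no division. *)
Definition rharmonic (h : X -> R) :=
  forall v, q.+1%:R * h v = \sum_(u <- fset_set (neighbours v)) h u.

Lemma rharmonic_origin h : rharmonic h ->
  \sum_(u <- children o) h u = q.+1%:R * h o.
Proof. by move=> /(_ o); rewrite (perm_big _ (neighbours_origin o)). Qed.

Lemma rharmonic_children h v : rharmonic h -> v != o ->
  \sum_(u <- children v) h u = q.+1%:R * h v - h (pred v).
Proof.
move=> /(_ v) hv vo; rewrite hv (perm_big _ (neighbours_children vo)) big_cons.
by rewrite addrAC subrr add0r.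
Qed.

Lemma rharmonic_lin c c' h h' : rharmonic h -> rharmonic h' ->
  rharmonic (fun x => c * h x + c' * h' x).
Proof.
move=> hh hh' v; rewrite big_split -!big_distrr /= -hh -hh'.
by rewrite mulrDr !(mulrCA q.+1%:R).
Qed.

Lemma rharmonic_cst c : rharmonic (fun=> c).
Proof.
move=> v; rewrite big_const_seq count_predT size_neighbours.
by rewrite iter_addr_0 mulr_natl.
Qed.

Let qR_neq0 : q%:R != 0 :> R.
Proof. by rewrite pnatr_eq0 -lt0n (ltn_trans _ q_gt1). Qed.

(** The coefficient a_(j-1), shifted so that the value 0 at j = 0 is the
    convention a_(-1) = 0. *)
Definition geosum (j : nat) : R := \sum_(0 <= i < j) q%:R ^- i.

Lemma geosumS j : geosum j.+1 = geosum j + q%:R ^- j.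
Proof. by rewrite /geosum big_nat_recr. Qed.

Lemma geosum0 : geosum 0 = 0. Proof. by rewrite /geosum big_nil. Qed.

(** The harmonicity equation for a function that depends only on the
    generation below a vertex. *)
Lemma geosum_rec j :
  q.+1%:R * geosum j.+1 = q%:R * geosum j.+2 + geosum j.
Proof.
rewrite (geosumS j.+1) (geosumS j) exprS -natr1.
have qj : q%:R ^+ j != 0 :> R by rewrite expf_neq0.
by field; rewrite qR_neq0 qj.
Qed.

Lemma geosum_ge0 j : 0 <= geosum j.
Proof. by apply: sumr_ge0 => i _; rewrite invr_ge0 exprn_ge0. Qed.

(** The sharper bound a_(j-1) <= 2 - 2 / q^j is the one that passes through
    the induction; it uses q >= 2. *)
Lemma geosum_le2 j : geosum j <= 2.
Proof.
suff: geosum j + 2 * q%:R ^- j <= 2.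
  by apply: le_trans; rewrite lerDl mulr_ge0 // invr_ge0 exprn_ge0.
elim: j => [|j IHj]; first by rewrite geosum0 expr0 invr1; lra.
apply: le_trans IHj; rewrite geosumS exprS invfM.
have q2 : 2 * q%:R^-1 <= 1 :> R.
  by rewrite ler_pdivrMr ?mul1r ?ler_nat // ltr0n (ltn_trans _ q_gt1).
have qj : 0 <= q%:R ^- j :> R by rewrite invr_ge0 exprn_ge0.
by nra.
Qed.

Lemma geosum_expr j :
  \sum_(0 <= k < j.+1) q%:R ^+ k = q%:R ^+ j * geosum j.+1.
Proof.
elim: j => [|j IHj]; first by rewrite geosumS geosum0 !big_nat1 expr0; lra.
rewrite big_nat_recl //= (eq_bigr (fun k => q%:R * q%:R ^+ k)); last first.
  by move=> k _; rewrite exprS.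
rewrite -big_distrr /= IHj expr0 (geosumS j.+1) mulrDr divff ?expf_neq0 //.
by rewrite exprS; ring.
Qed.

Lemma sum_pred_descendants h y j :
  \sum_(x <- descendants y j.+1) h (pred x) =
  \sum_(w <- descendants y j) (size (children w))%:R * h w.
Proof.
rewrite sum_descendantsS; apply: eq_bigr => w _.
rewrite (eq_big_seq (fun=> h w)); last first.
  by move=> u; rewrite mem_children => /andP[_ /eqP ->].
by rewrite big_const_seq count_predT iter_addr_0 mulr_natl.
Qed.

Lemma descendants_neq_origin y j x : y != o -> x \in descendants y j -> x != o.
Proof.
rewrite -!(height_eq0 o) -!lt0n => yo /descendantsP[-> _].
by rewrite ltn_addr.
Qed.

(** Summing the mean value property over a generation gives
    S_(j+1) = (q + 1) S_j - P_j, where P_j sums h over the predecessors of the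
    j-th generation; P_(j+1) = q S_j since every vertex other than o
    has q successors. *)
Lemma sum_descendants h y j : rharmonic h -> y != o ->
  \sum_(x <- descendants y j) h x =
  q%:R ^+ j * (geosum j.+1 * h y - (geosum j.+1 - 1) * h (pred y)).
Proof.
move=> hh yo.
have sumq i : \sum_(x <- descendants y i.+1) h (pred x) =
    q%:R * \sum_(x <- descendants y i) h x.
  rewrite sum_pred_descendants big_distrr /=; apply: eq_big_seq => w.
  move=> /(descendants_neq_origin yo) /negbTE wo.
  by rewrite size_children wo addn0.
(* The second equation is the first at j - 1, in a form valid at j = 0. *)
suff [] : \sum_(x <- descendants y j) h x =
  q%:R ^+ j * (geosum j.+1 * h y - (geosum j.+1 - 1) * h (pred y)) /\
  \sum_(x <- descendants y j) h (pred x) =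
  q%:R ^+ j * (geosum j * h y - (geosum j - 1) * h (pred y)) by [].
elim: j => [|j [IH IHp]].
  rewrite !big_seq1 geosumS geosum0 expr0 invr1; split; ring.
rewrite sumq IH sum_descendantsS.
rewrite (eq_big_seq (fun w => q.+1%:R * h w - h (pred w))); last first.
  by move=> w /(descendants_neq_origin yo)/(rharmonic_children hh).
rewrite sumrB -big_distrr /= IH IHp; split; last by rewrite exprS mulrA.
have := geosum_rec j; set a := geosum j.+2; set b := geosum j.+1.
set c := geosum j => abc.
have -> : c = q.+1%:R * b - q%:R * a by rewrite abc addrC addKr.
by rewrite exprS -natr1; ring.
Qed.

(** The sum is a multiple of h(o) with a factor independent of h, and the
    constant function 1 identifies the factor as the size of the sphere. *)
Lemma sum_sphere h k : rharmonic h ->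
  \sum_(x <- descendants o k) h x = (size (descendants o k))%:R * h o.
Proof.
suff [c cE] : exists c : R, forall g, rharmonic g ->
    \sum_(x <- descendants o k) g x = c * g o.
  move=> hh; rewrite cE //; congr (_ * _).
  rewrite -[LHS]mulr1 -(cE _ (rharmonic_cst 1)).
  by rewrite big_const_seq count_predT iter_addr_0.
case: k => [|j]; first by exists 1 => g _; rewrite big_seq1 mul1r.
exists (q%:R ^+ j * q.+1%:R) => g hg.
rewrite -add1n sum_descendantsD /= cats0.
rewrite (eq_big_seq (fun y =>
    q%:R ^+ j * (geosum j.+1 * g y - (geosum j.+1 - 1) * g o))); last first.
  move=> y; rewrite mem_children => /andP[yo /eqP py].
  by rewrite sum_descendants // py.
rewrite -big_distrr sumrB -!big_distrr /= rharmonic_origin //.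
rewrite big_const_seq count_predT iter_addr_0 size_children eqxx addn1.
by rewrite -[g o *+ _]mulr_natl; ring.
Qed.

Lemma size_descendants y j : y != o -> size (descendants y j) = (q ^ j)%N.
Proof.
move=> yo; apply/eqP; rewrite -(eqr_nat R) natrX.
have := sum_descendants j (rharmonic_cst 1) yo.
rewrite big_const_seq count_predT iter_addr_0 => ->.
by apply/eqP; ring.
Qed.

Lemma leq_size_sphere n j : (q ^ j <= size (descendants o (n.+1 + j)))%N.
Proof.
rewrite -(ler_nat R).
have -> : (size (descendants o (n.+1 + j)))%:R =
    \sum_(x <- descendants o (n.+1 + j)) 1 :> R.
  by rewrite big_const_seq count_predT iter_addr_0.
rewrite sum_descendantsD (eq_big_seq (fun=> (q ^ j)%:R)); last first.
  move=> y; rewrite mem_sphere => /eqP hy.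
  rewrite big_const_seq count_predT iter_addr_0 size_descendants //.
  by rewrite -(height_eq0 o) hy.
rewrite big_const_seq count_predT iter_addr_0 -mulrnA ler_nat leq_pmulr //.
elim: n => [|n IHn]; first by rewrite /= cats0 size_children eqxx addn1.
case E : (descendants o n.+1) IHn => [//|y s] _.
have : (0 < size (children y))%N.
  by rewrite size_children (leq_trans _ (leq_addr _ _)) // ltnW.
case Ey : (children y) => [//|u t] _.
have : u \in descendants o n.+2.
  apply/flatten_mapP; exists y; last by rewrite Ey mem_head.
  by rewrite -[X in _ \in X]/(descendants o n.+1) E mem_head.
by case: (descendants o n.+2).
Qed.

(** The harmonic extension of a function that vanishes on the ball of radius
    n and equals gam on the next sphere.  As [geosum] vanishes at 0, the
    truncated subtraction makes the formula valid inside the ball too. *)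
Definition radial_lift (n : nat) (gam : X -> R) (x : X) : R :=
  geosum (height x - n) * gam (iter (height x - n).-1 pred x).

Lemma radial_lift_ball n gam x : (height x <= n)%N -> radial_lift n gam x = 0.
Proof. by rewrite /radial_lift -subn_eq0 => /eqP->; rewrite geosum0 mul0r. Qed.

Lemma radial_lift_descendants n gam y j x : height y = n.+1 ->
  x \in descendants y j -> radial_lift n gam x = geosum j.+1 * gam y.
Proof.
move=> hy /descendantsP[hx itx].
by rewrite /radial_lift hx hy addSnnS addKn /= itx.
Qed.

Lemma radial_lift_bounded n gam M : (forall x, `|gam x| <= M) ->
  forall x, `|radial_lift n gam x| <= 2 * M.
Proof.
move=> gM x; rewrite normrM ger0_norm ?geosum_ge0 //.
by rewrite ler_pM // ?geosum_ge0 // geosum_le2.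
Qed.

(** The condition on sphere data under which the extension by zero inside the
    ball is harmonic at the vertices of height n. *)
Definition balanced n (gam : X -> R) :=
  forall w, height w = n -> \sum_(u <- children w) gam u = 0.

(** Inside the ball both sides vanish, at height n the equation is the balance
    condition, and further out it is [geosum_rec]. *)
Lemma rharmonic_radial_lift n gam : balanced n gam ->
  rharmonic (radial_lift n gam).
Proof.
move=> bal v.
have sum_low : (height v <= n)%N ->
    \sum_(u <- children v) radial_lift n gam u = 0.
  rewrite leq_eqVlt => /orP[/eqP hv|hv].
    rewrite -[RHS](bal v hv); apply: eq_big_seq => u /height_children hu.
    by rewrite /radial_lift hu hv subSnn /= geosumS geosum0 expr0 invr1 add0r
      mul1r.
  by rewrite big_seq big1 // => u /height_children hu;
    rewrite radial_lift_ball // hu.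
have [vo|vo] := eqVneq v o.
  have hv : (height v <= n)%N by rewrite vo height_origin.
  have nbr : perm_eq (fset_set (neighbours v)) (children v).
    by rewrite vo neighbours_origin.
  by rewrite (perm_big _ nbr) /= sum_low // radial_lift_ball ?mulr0.
rewrite (perm_big _ (neighbours_children vo)) big_cons /=.
have [hv|hv] := leqP (height v) n.
  have hp : (height (pred v) <= n)%N.
    by rewrite ltnW // height_predecessor.
  by rewrite sum_low // (radial_lift_ball _ hv) (radial_lift_ball _ hp) mulr0
    addr0.
have {sum_low} -> : \sum_(u <- children v) radial_lift n gam u =
    q%:R * (geosum (height v - n).+1 * gam (iter (height v - n).-1 pred v)).
  rewrite (eq_big_seq (fun=>
    geosum (height v - n).+1 * gam (iter (height v - n).-1 pred v))).
    rewrite big_const_seq count_predT iter_addr_0 size_children (negbTE vo).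
    by rewrite addn0 mulr_natl.
  move=> u uv; rewrite /radial_lift (height_children uv) subSn ?(ltnW hv) //=.
  move: uv; rewrite mem_children => /andP[_ /eqP pu].
  have <- : (height v - n).-1.+1 = (height v - n)%N by rewrite prednK //
    subn_gt0.
  by rewrite iterSr pu.
have hp := height_predecessor vo.
rewrite /radial_lift; have -> : (height (pred v) - n = (height v - n).-1)%N.
  by rewrite -hp -subnS subSS.
have : (0 < height v - n)%N by rewrite subn_gt0.
case: (height v - n)%N => // -[|j] _ /=.
  have := geosum_rec 0; rewrite geosum0 addr0 => e.
  by rewrite mul0r add0r !mulrA e.
by rewrite mulrA geosum_rec -iterSr -[X in X = _]/(_ * gam (iter j.+1 pred v));
  ring.
Qed.

Lemma sum_sphere_radial_lift_low n gam h k : (k <= n)%N ->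
  \sum_(x <- descendants o k) h x * radial_lift n gam x = 0.
Proof.
move=> kn; rewrite big_seq big1 // => x; rewrite mem_sphere => /eqP hx.
by rewrite radial_lift_ball ?mulr0 // hx.
Qed.

(** Below each y the extension is constant on generations, so
    [sum_descendants] applies; the contribution of h(p(y)) disappears because
    gam sums to zero over siblings. *)
Lemma sum_sphere_radial_lift n gam h j : rharmonic h -> balanced n gam ->
  \sum_(x <- descendants o (n.+1 + j)) h x * radial_lift n gam x =
  geosum j.+1 * (q%:R ^+ j * geosum j.+1) *
  \sum_(y <- descendants o n.+1) h y * gam y.
Proof.
move=> hh bal.
have pred0 : \sum_(y <- descendants o n.+1) gam y * h (pred y) = 0.
  rewrite sum_descendantsS big_seq big1 // => w; rewrite mem_sphere => /eqP hw.
  rewrite (eq_big_seq (fun u => gam u * h w)); last first.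
    by move=> u; rewrite mem_children => /andP[_ /eqP ->].
  by rewrite -big_distrl /= bal // mul0r.
rewrite sum_descendantsD (eq_big_seq (fun y =>
    geosum j.+1 * (q%:R ^+ j * geosum j.+1) * (h y * gam y)
    - geosum j.+1 * q%:R ^+ j * (geosum j.+1 - 1) * (gam y * h (pred y)))).
  by rewrite sumrB -!big_distrr /= pred0 mulr0 subr0.
move=> y; rewrite mem_sphere => /eqP hy.
rewrite (eq_big_seq (fun x => h x * (geosum j.+1 * gam y))); last first.
  by move=> x /(radial_lift_descendants gam hy) ->.
rewrite -big_distrl /= sum_descendants //; last by rewrite -(height_eq0 o) hy.
ring.
Qed.

End HarmonicSums.

(** * Infinite sums as limits over balls *)

Section BallSums.
Variables (R : realType) (q : nat) (X : homogeneousTree q) (o : X).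
Notation descendants := (descendants o).
Implicit Types F G : X -> R.

Definition ballsum F (N : nat) : R :=
  \sum_(0 <= k < N) \sum_(x <- descendants o k) F x.

Lemma ballsum_ge0 F N : (forall x, 0 <= F x) -> 0 <= ballsum F N.
Proof. by move=> F0; apply: sumr_ge0 => k _; apply: sumr_ge0. Qed.

Lemma ballsum_le F G N : (forall x, F x <= G x) -> ballsum F N <= ballsum G N.
Proof. by move=> FG; apply: ler_sum => k _; apply: ler_sum. Qed.

Lemma ballsum_lin c c' F G N :
  ballsum (fun x => c * F x + c' * G x) N = c * ballsum F N + c' * ballsum G N.
Proof.
rewrite /ballsum !big_distrr -big_split; apply: eq_bigr => k _ /=.
by rewrite !big_distrr -big_split.
Qed.

Lemma ballsum_nondecreasing F : (forall x, 0 <= F x) ->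
  nondecreasing_seq (ballsum F).
Proof. by move=> F0; apply: nondecreasing_series => k _ _; apply: sumr_ge0. Qed.

Lemma esum_spheres F : (forall x, 0 <= F x) ->
  (\esum_(x in [set: X]) (F x)%:E =
   \sum_(0 <= k <oo) (\sum_(x <- descendants o k) F x)%:E)%E.
Proof.
move=> F0; have -> : [set: X] = \bigcup_k sphere o k.
  by apply/seteqP; split=> // x _; exists (height o x).
have triv : trivIset [set: nat] (sphere o) by move=> i j _ _ [x [<- <-]].
rewrite (nneseries_sum_bigcup (f := fun x => (F x)%:E) triv) => [|x];
  last first.
  by rewrite lee_fin.
apply: eq_eseriesr => k _.
have -> : sphere o k = [set` descendants o k].
  by apply/seteqP; split=> x /=; rewrite mem_sphere => /eqP.
rewrite esum_fset => [|//|x _]; last by rewrite lee_fin.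
by rewrite -fsbig_seq ?uniq_descendants // sumEFin.
Qed.

Lemma ballsum_cvg_esum F : (forall x, 0 <= F x) ->
  (fun N => (ballsum F N)%:E) @ \oo --> (\esum_(x in [set: X]) (F x)%:E)%E.
Proof.
move=> F0; rewrite esum_spheres //.
rewrite (_ : (fun N => _) =
   fun N => (\sum_(0 <= k < N) (\sum_(x <- descendants o k) F x)%:E)%E);
     last first.
  by apply/funext => N; rewrite sumEFin.
by apply: is_cvg_nneseries => k _ _; rewrite lee_fin sumr_ge0.
Qed.

(** Absolute summability in a form that avoids extended reals; see
    [ball_summableP] for the equivalence with unconditional sums. *)
Definition ball_summable F :=
  exists M, forall N, ballsum (fun x => `|F x|) N <= M.

Lemma ball_summableP F : (forall x, 0 <= F x) ->
  ball_summable F <-> (\esum_(x in [set: X]) (F x)%:E < +oo)%E.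
Proof.
move=> F0; have cvgF := ballsum_cvg_esum F0.
have abs N : ballsum (fun x => `|F x|) N = ballsum F N.
  by congr ballsum; apply/funext => x; rewrite ger0_norm.
split=> [[M leM]|fin].
  rewrite -(cvg_lim _ cvgF) //; apply: le_lt_trans (ltry M).
  apply: lime_le; first by apply/cvg_ex; eexists; exact: cvgF.
  by apply: nearW => N; rewrite lee_fin -abs.
have E0 : (0 <= \esum_(x in [set: X]) (F x)%:E)%E.
  by apply: esum_ge0 => x _; rewrite lee_fin.
exists (fine (\esum_(x in [set: X]) (F x)%:E)%E) => N; rewrite abs -lee_fin.
rewrite fineK ?ge0_fin_numE // -(cvg_lim _ cvgF) //.
apply: lime_ge; first by apply/cvg_ex; eexists; exact: cvgF.
exists N => // n /= Nn; rewrite lee_fin.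
exact: ballsum_nondecreasing.
Qed.

Lemma ball_summable_le F G : (forall x, `|G x| <= F x) -> ball_summable F ->
  ball_summable G.
Proof.
move=> GF [M FM]; exists M => N; apply: le_trans (FM N).
by apply: ballsum_le => x; rewrite (le_trans (GF x)) // ler_norm.
Qed.

Lemma ball_summable_lin c c' F G : ball_summable F -> ball_summable G ->
  ball_summable (fun x => c * F x + c' * G x).
Proof.
move=> [M FM] [M' GM']; exists (`|c| * M + `|c'| * M') => N.
apply: (@le_trans _ _ (ballsum (fun x => `|c| * `|F x| + `|c'| * `|G x|) N)).
  by apply: ballsum_le => x; rewrite -!normrM ler_normD.
by rewrite ballsum_lin lerD // ler_wpM2l.
Qed.

Lemma ball_summable_norm F : ball_summable F -> ball_summable (fun x => `|F x|).
Proof.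
by case=> M FM; exists M => N; under [fun x => _]funext do rewrite normr_id.
Qed.

Lemma ballsum_cvg_nneg F : (forall x, 0 <= F x) -> ball_summable F ->
  ballsum F @ \oo --> fine (\esum_(x in [set: X]) (F x)%:E)%E.
Proof.
move=> F0 /(ball_summableP F0) fin; apply: (@fine_cvg _ _ _ _ (EFin \o ballsum
  F)).
rewrite fineK; first exact: ballsum_cvg_esum.
by rewrite ge0_fin_numE // esum_ge0 // => x _; rewrite lee_fin.
Qed.

(** Both the positive and the negative part are nonnegative families, whose
    unconditional sum is the supremum of the sums over balls. *)
Lemma rsum_cvg F : ball_summable F -> ballsum F @ \oo --> rsum F.
Proof.
move=> sF; pose Fp x := Num.max (F x) 0; pose Fn x := Num.max (- F x) 0.
have Fp0 x : 0 <= Fp x by rewrite le_max lexx orbT.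
have Fn0 x : 0 <= Fn x by rewrite le_max lexx orbT.
have sFp : ball_summable Fp.
  apply: ball_summable_le (ball_summable_norm sF) => x; rewrite ger0_norm //.
  by rewrite ge_max normr_ge0 ler_norm.
have sFn : ball_summable Fn.
  apply: ball_summable_le (ball_summable_norm sF) => x; rewrite ger0_norm //.
  by rewrite ge_max normr_ge0 -normrN ler_norm.
have -> : rsum F = fine (\esum_(x in [set: X]) (Fp x)%:E)%E
                 - fine (\esum_(x in [set: X]) (Fn x)%:E)%E.
  rewrite /rsum -fineB; last 2 first.
  - by rewrite ge0_fin_numE ?esum_ge0 //; [exact/ball_summableP | move=> x _;
    rewrite lee_fin].
  - by rewrite ge0_fin_numE ?esum_ge0 //; [exact/ball_summableP | move=> x _;
    rewrite lee_fin].
  congr (fine (_ - _)%E); apply: eq_esum => x _.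
    by rewrite funeposE /= EFin_max.
  by rewrite funenegE /= EFin_max EFinN.
have -> : ballsum F = (fun N => ballsum Fp N - ballsum Fn N).
  apply/funext => N; have := ballsum_lin 1 (-1) Fp Fn N.
  rewrite mul1r mulN1r => <-; congr ballsum; apply/funext => x.
  rewrite mul1r mulN1r /Fp /Fn; case/orP: (le_total (F x) 0) => Fx.
    by rewrite (max_idPr Fx) (max_idPl _) ?oppr_ge0 // opprK add0r.
  by rewrite (max_idPl Fx) (max_idPr _) ?oppr_le0 // subr0.
by apply: cvgB; exact: ballsum_cvg_nneg.
Qed.

Lemma rsum_eq F l : ball_summable F -> ballsum F @ \oo --> l -> rsum F = l.
Proof. by move=> /rsum_cvg cF cl; exact: cvg_unique cF cl. Qed.

Lemma rsum_lin c c' F G : ball_summable F -> ball_summable G ->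
  rsum (fun x => c * F x + c' * G x) = c * rsum F + c' * rsum G.
Proof.
move=> sF sG; apply: rsum_eq; first exact: ball_summable_lin.
rewrite (_ : ballsum _ = fun N => c * ballsum F N + c' * ballsum G N);
  last first.
  by apply/funext => N; rewrite ballsum_lin.
by apply: cvgD; apply: cvgMl_tmp; exact: rsum_cvg.
Qed.

Lemma rsum_eq0 F : (forall x, 0 <= F x) -> ball_summable F -> rsum F = 0 ->
  forall x, F x = 0.
Proof.
move=> F0 sF rF x; apply/eqP; rewrite eq_le F0 andbT -rF.
have cF := rsum_cvg sF.
rewrite -(cvg_lim _ cF) //.
have /(_ (height o x).+1) := nondecreasing_cvgn_le (ballsum_nondecreasing F0)
  (cvgP _ cF).
apply: le_trans; rewrite /ballsum big_nat_recr //=.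
rewrite -[leLHS]add0r lerD ?ballsum_ge0 //.
have xh : x \in descendants o (height o x) by rewrite mem_sphere.
rewrite (bigD1_seq x) ?uniq_descendants //= lerDl.
by apply: sumr_ge0.
Qed.

End BallSums.

(** * Real representing functions *)

Section Kernel.
Variables (R : realType) (q : nat) (X : homogeneousTree q) (o : X).
Hypothesis q_gt1 : (1 < q)%N.
Variable sigma : X -> R.
Hypothesis sigmaP : reference_measure o sigma.
Notation height := (height o).
Notation pred := (predecessor o).
Notation children := (children o).
Notation descendants := (descendants o).
Notation ball_summable := (ball_summable o).
Notation ballsum := (ballsum o).
Implicit Types (F h : X -> R) (L : (X -> R) -> R).

Let sigma_gt0 : forall x, 0 < sigma x := refm_gt0 sigmaP.

Lemma ball_summable_sigma : ball_summable sigma.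
Proof. by apply/ball_summableP; [move=> x; exact: ltW | exact: refm_finite
  sigmaP]. Qed.

Lemma sigma_atE x : sigma_at o sigma (height x) = sigma x.
Proof.
apply: (refm_radial sigmaP).
exact: (@xgetPex X o (sphere o (height x)) (ex_intro _ x erefl)).
Qed.

Lemma sigma_at_gt0 n : 0 < sigma_at o sigma n. Proof. exact: sigma_gt0. Qed.

Definition b_term n m : R :=
  sigma_at o sigma m * a_coef R q (m - n - 1) *
    \sum_(0 <= k < (m - n - 1).+1) q%:R ^+ k.

Lemma b_termE n j : b_term n (n.+1 + j) =
  sigma_at o sigma (n.+1 + j) *
    (geosum R q j.+1 * (q%:R ^+ j * geosum R q j.+1)).
Proof.
rewrite /b_term (_ : n.+1 + j - n - 1 = j)%N;
  last by rewrite addSnnS addKn subn1.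
by rewrite geosum_expr // -mulrA.
Qed.

Lemma b_term_ge0 n m : 0 <= b_term n m.
Proof.
rewrite mulr_ge0 ?mulr_ge0 ?(ltW (sigma_at_gt0 _)) //.
- exact: geosum_ge0.
- by apply: sumr_ge0 => k _; rewrite exprn_ge0.
Qed.

Lemma sum_sphere_sigma F k :
  \sum_(x <- descendants o k) F x * sigma x =
  sigma_at o sigma k * \sum_(x <- descendants o k) F x.
Proof.
rewrite mulrC big_distrl /=; apply: eq_big_seq => x.
by rewrite mem_sphere => /eqP <-; rewrite sigma_atE.
Qed.

(** The sphere of radius m contains at least q^(m-n-1) vertices and a_j <= 2,
    so the series of b_n is dominated by four times the total mass of sigma. *)
Lemma b_term_le n m : (n < m)%N ->
  b_term n m <= 4 * \sum_(x <- descendants o m) sigma x.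
Proof.
move=> /subnKC <-; set j := (m - n.+1)%N; rewrite b_termE.
have -> : \sum_(x <- descendants o (n.+1 + j)) sigma x =
    sigma_at o sigma (n.+1 + j) * (size (descendants o (n.+1 + j)))%:R.
  rewrite -[LHS](_ : \sum_(x <- descendants o (n.+1 + j)) 1 * sigma x = _);
    last first.
    by apply: eq_bigr => x _; rewrite mul1r.
  rewrite sum_sphere_sigma; congr (_ * _).
  by rewrite big_const_seq count_predT iter_addr_0.
rewrite [leRHS]mulrCA ler_wpM2l ?(ltW (sigma_at_gt0 _)) //.
have g0 := geosum_ge0 R q j.+1; have g2 := geosum_le2 R q_gt1 j.+1.
have qs : q%:R ^+ j <= (size (descendants o (n.+1 + j)))%:R :> R.
  by rewrite -natrX ler_nat; exact: (leq_size_sphere R).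
have q0 : 0 <= q%:R ^+ j :> R by rewrite exprn_ge0.
rewrite mulrCA -expr2 mulrC ler_pM ?sqr_ge0 //.
by rewrite -[4%:R](_ : 2 ^+ 2 = _) ?ler_sqr ?nnegrE //; lra.
Qed.

Definition b_partial n N : R := \sum_(n.+1 <= m < N) b_term n m.

Lemma b_partial_bounded n : exists M, forall N, b_partial n N <= M.
Proof.
have [M sM] := ball_summable_sigma; exists (4 * M) => N.
apply: (@le_trans _ _ (4 * ballsum (fun x => `|sigma x|) N)); last first.
  by rewrite ler_wpM2l.
have [Nn|nN] := leqP N n.+1.
  by rewrite /b_partial big_geq // mulr_ge0 // ballsum_ge0.
rewrite /ballsum (big_cat_nat (n := n.+1)) ?(ltnW nN) //= mulrDr.
rewrite -[leLHS]add0r lerD //.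
  by rewrite mulr_ge0 // sumr_ge0 // => k _; rewrite sumr_ge0.
rewrite big_distrr /=; apply: ler_sum_nat => m /andP[nm _].
rewrite (le_trans (b_term_le nm)) // ler_wpM2l //.
by apply: ler_sum => x _; rewrite ler_norm.
Qed.

Lemma b_partial_cvg n : b_partial n @ \oo --> b_coef o sigma n.
Proof.
rewrite /b_coef -/(b_term n).
have t0 m : (n < m)%N -> true -> (0 <= (b_term n m)%:E)%E.
  by move=> _ _; rewrite lee_fin b_term_ge0.
have cv : (fun N => (b_partial n N)%:E) @ \oo -->
    (\sum_(n.+1 <= m <oo) (b_term n m)%:E)%E.
  rewrite (_ : (fun N => _) =
      fun N => (\sum_(n.+1 <= m < N) (b_term n m)%:E)%E).
    exact: is_cvg_nneseries.
  by apply/funext => N; rewrite sumEFin.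
apply: (@fine_cvg _ _ _ _ (EFin \o b_partial n)).
rewrite fineK // ge0_fin_numE; last exact: nneseries_ge0.
have [M bM] := b_partial_bounded n.
rewrite -(cvg_lim _ cv) //; apply: le_lt_trans (ltry M).
apply: lime_le; first by apply/cvg_ex; eexists; exact: cv.
by apply: nearW => N; rewrite lee_fin.
Qed.

Lemma b_coef_gt0 n : 0 < b_coef o sigma n.
Proof.
have nd : nondecreasing_seq (b_partial n).
  apply/nondecreasing_seqP => N; rewrite /b_partial.
  have [Nn|nN] := leqP n.+1 N; first by rewrite big_nat_recr //= lerDl
    b_term_ge0.
  by rewrite !big_geq // ltnW.
rewrite -(cvg_lim _ (b_partial_cvg (n := n))) //.
apply: lt_le_trans (nondecreasing_cvgn_le nd (cvgP _ (b_partial_cvg (n := n)))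
  n.+2).
rewrite /b_partial big_nat1 -[n.+1]addn0 b_termE geosumS geosum0 expr0 invr1.
by rewrite add0r !mulr1 sigma_at_gt0.
Qed.

(** Testing against all harmonic functions that are integrable for sigma, and
    not only the square-integrable ones, keeps the property real-linear and
    independent of the Hilbert space; boundedness of k makes the pairing
    converge. *)
Definition represents L (k : X -> R) :=
  [/\ rharmonic k, exists M, forall x, `|k x| <= M
  & forall h, rharmonic h -> ball_summable (fun x => h x * sigma x) ->
      ball_summable (fun x => h x * k x * sigma x) /\
      rsum (fun x => h x * k x * sigma x) = L h].

Lemma ball_summable_bounded h (k : X -> R) M : (forall x, `|k x| <= M) ->
  ball_summable (fun x => h x * sigma x) -> ball_summable (fun x =>
    h x * k x * sigma x).
Proof.
move=> kM sh.
have M0 : 0 <= M by rewrite (le_trans _ (kM o)).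
apply: (@ball_summable_le _ _ _ _ (fun x => M * `|h x * sigma x| + 0 * `|h x *
  sigma x|)).
  by move=> x; rewrite mul0r addr0 mulrAC mulrC normrM ler_wpM2r.
by apply: ball_summable_lin; exact: ball_summable_norm.
Qed.

Lemma represents_lin c c' L L' k k' : represents L k -> represents L' k' ->
  represents (fun h => c * L h + c' * L' h) (fun x => c * k x + c' * k' x).
Proof.
move=> [hk [M kM] kL] [hk' [M' kM'] kL']; split; first exact: rharmonic_lin.
  exists (`|c| * M + `|c'| * M') => x.
  by rewrite (le_trans (ler_normD _ _)) // !normrM lerD // ler_wpM2l.
move=> h hh sh; have [s1 r1] := kL h hh sh; have [s2 r2] := kL' h hh sh.
have -> : (fun x => h x * (c * k x + c' * k' x) * sigma x) =
    fun x => c * (h x * k x * sigma x) + c' * (h x * k' x * sigma x).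
  by apply/funext => x; ring.
by split; [exact: ball_summable_lin | rewrite (rsum_lin _ _ s1 s2) r1 r2].
Qed.

Lemma represents_ext L L' (k k' : X -> R) :
  (forall h, rharmonic h -> L h = L' h) -> k =1 k' ->
  represents L k -> represents L' k'.
Proof.
move=> LL' /funext <- [? ? kL]; split=> // h hh sh.
by rewrite -LL' //; exact: kL.
Qed.

(** By [sum_sphere], the pairing of h with a constant over a ball is h(o)
    times the mass of the ball. *)
Lemma represents_origin : represents (fun h => h o) (fun=> (B_sigma sigma)^-1).
Proof.
have cB : ballsum sigma @ \oo --> B_sigma sigma.
  by apply: ballsum_cvg_nneg; [move=> x; exact: ltW | exact:
    ball_summable_sigma].
have B0 : 0 < B_sigma sigma.
  have nd := ballsum_nondecreasing o (fun x => ltW (sigma_gt0 x)).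
  rewrite -(cvg_lim _ cB) //.
  apply: lt_le_trans (nondecreasing_cvgn_le nd (cvgP _ cB) 1%N).
  by rewrite /ballsum big_nat1 big_seq1.
have bnd x : `|(fun=> (B_sigma sigma)^-1 : R) (x : X)| <= (B_sigma sigma)^-1.
  by rewrite ger0_norm // invr_ge0 ltW.
split; first exact: rharmonic_cst.
  by exists (B_sigma sigma)^-1.
move=> h hh sh; have s := ball_summable_bounded bnd sh; split=> //.
apply: rsum_eq s _.
have -> : ballsum (fun x => h x * (B_sigma sigma)^-1 * sigma x) =
    fun N => h o / B_sigma sigma * ballsum sigma N.
  apply/funext => N; rewrite /ballsum big_distrr; apply: eq_bigr => k _ /=.
  rewrite sum_sphere_sigma -big_distrl /= sum_sphere //.
  rewrite (eq_bigr (fun x => 1 * sigma x)); last by move=> x _; rewrite mul1r.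
  rewrite sum_sphere_sigma big_const_seq count_predT iter_addr_0.
  by ring.
rewrite -[X in _ --> X](_ : h o / B_sigma sigma * B_sigma sigma = _).
  exact: cvgMl_tmp.
by rewrite mulfVK // gt_eqF.
Qed.

Lemma represents_lift n gam : balanced o n gam ->
  (exists M, forall x, `|gam x| <= M) ->
  represents (fun h => b_coef o sigma n * \sum_(y <- descendants o n.+1) h y *
    gam y)
    (radial_lift o n gam).
Proof.
move=> bal [M gM]; have bnd := radial_lift_bounded o q_gt1 n gM.
split; first exact: rharmonic_radial_lift.
  by exists (2 * M).
move=> h hh sh; have s := ball_summable_bounded bnd sh; split=> //.
apply: rsum_eq s _; set C := \sum_(y <- _) _.
rewrite (_ : ballsum _ = fun N => b_partial n N * C).
  by apply: cvgMr_tmp; exact: b_partial_cvg.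
apply/funext => N; rewrite /b_partial big_distrl /= big_geq_mkord /=.
rewrite /ballsum big_mkord [RHS]big_mkcond; apply: eq_bigr => -[m /= _] _.
rewrite (sum_sphere_sigma (fun x => h x * radial_lift o n gam x)).
have [nm|mn] := ltnP n m; last by rewrite sum_sphere_radial_lift_low // mulr0.
by rewrite -(subnKC nm) sum_sphere_radial_lift // b_termE !mulrA.
Qed.

(** The values of Gamma(p(z), z, .) on the sphere through z. *)
Definition sibling_weight (z y : X) : R :=
  if (y != o) && (pred y == pred z)
  then (y == z)%:R - (size (children (pred z)))%:R^-1 else 0.

Lemma sum_sibling_weight h z w : z != o ->
  \sum_(y <- children w) h y * sibling_weight z y =
  if w == pred z then h z - (size (children w))%:R^-1 * \sum_(y <- children w) h
    y
  else 0.
Proof.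
move=> zo; have [->|wz] := eqVneq w (pred z); last first.
  rewrite big_seq big1 // => y; rewrite mem_children /sibling_weight =>
    /andP[-> /eqP ->].
  by rewrite (negbTE wz) mulr0.
rewrite (eq_big_seq (fun y => h y * (y == z)%:R
    - (size (children (pred z)))%:R^-1 * h y)); last first.
  by move=> y; rewrite mem_children /sibling_weight => ->; ring.
rewrite sumrB -big_distrr /=; congr (_ - _).
have zc : z \in children (pred z) by rewrite mem_children zo eqxx.
rewrite (bigD1_seq z) ?uniq_children //= eqxx mulr1 big1 ?addr0 //.
by move=> y /negbTE ->; rewrite mulr0.
Qed.

Lemma size_children_neq0 v : (size (children v))%:R != 0 :> R.
Proof. by rewrite pnatr_eq0 -lt0n size_children (leq_trans _ (leq_addr _ _)) //
  ltnW. Qed.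

Lemma balanced_sibling_weight z n : z != o -> balanced o n (sibling_weight z).
Proof.
move=> zo w _; have := sum_sibling_weight (fun=> 1) w zo.
rewrite (eq_bigr (sibling_weight z)) => [->|y _]; last by rewrite mul1r.
case: ifP => // _; rewrite big_const_seq count_predT iter_addr_0.
by rewrite mulVf ?subrr // size_children_neq0.
Qed.

Lemma sibling_weight_bounded z : exists M, forall y, `|sibling_weight z y| <= M.
Proof.
exists (1 + (size (children (pred z)))%:R^-1) => y; rewrite /sibling_weight.
case: ifP => _; last by rewrite normr0 addr_ge0.
rewrite (le_trans (ler_normB _ _)) // lerD //; first by case: (y == z);
  rewrite ?normr1 ?normr0.
by rewrite ger0_norm.
Qed.

Lemma sum_sphere_sibling_weight h z : z != o ->
  \sum_(y <- descendants o (height z)) h y * sibling_weight z y =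
  h z - (size (children (pred z)))%:R^-1 * \sum_(y <- children (pred z)) h y.
Proof.
move=> zo; rewrite -(height_predecessor zo) sum_descendantsS.
under eq_bigr => w _ do rewrite sum_sibling_weight //.
rewrite (bigD1_seq (pred z)) ?uniq_descendants ?mem_sphere //= eqxx.
by rewrite [X in _ + X]big1 ?addr0 // => w /negbTE ->.
Qed.

(** After division by b_n the extension of the sibling weights represents the
    deviation of h(z) from its mean over the siblings of z. *)
Lemma represents_sibling z : z != o ->
  represents (fun h => h z - (size (children (pred z)))%:R^-1 *
      \sum_(y <- children (pred z)) h y)
    (fun x => (b_coef o sigma (height z).-1)^-1
       * radial_lift o (height z).-1 (sibling_weight z) x).
Proof.
move=> zo; set n := (height z).-1.
have hz : n.+1 = height z by rewrite /n -(height_predecessor zo).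
have rl := represents_lift (balanced_sibling_weight (n := n) zo)
  (sibling_weight_bounded z).
apply: represents_ext (represents_lin (b_coef o sigma n)^-1 0 rl rl) => [h _|x].
2: by rewrite mul0r addr0.
rewrite mul0r addr0 mulKf ?gt_eqF ?b_coef_gt0 // hz.
exact: sum_sphere_sibling_weight.
Qed.

(** By harmonicity at o, the mean of h over the siblings of z is h(o). *)
Lemma represents_child z : z != o -> pred z = o ->
  forall k, represents (fun h => h o) k ->
  represents (fun h => h z) (fun x => k x + (b_coef o sigma 0)^-1
       * radial_lift o 0 (sibling_weight z) x).
Proof.
move=> zo pz k rk; have := represents_lin 1 1 rk (represents_sibling zo).
rewrite -(height_predecessor zo) pz height_origin /=.
apply: represents_ext => [h hh|x]; rewrite !mul1r // rharmonic_origin //.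
have := size_children_neq0 o; rewrite size_children eqxx addn1 => q0.
by rewrite mulKf //; ring.
Qed.

(** By harmonicity at v = p(z), the mean of h over the q siblings of z is
    ((q + 1) h(v) - h(p(v))) / q. *)
Lemma represents_grandchild z : z != o -> pred z != o ->
  forall k k', represents (fun h => h (pred (pred z))) k ->
  represents (fun h => h (pred z)) k' ->
  represents (fun h => h z) (fun x => - q%:R^-1 * k x + (q.+1%:R / q%:R) * k' x
      + (b_coef o sigma (height z).-1)^-1
       * radial_lift o (height z).-1 (sibling_weight z) x).
Proof.
move=> zo pz k k' rk rk'.
have := represents_lin 1 1 (represents_lin (- q%:R^-1) (q.+1%:R / q%:R) rk rk')
  (represents_sibling zo).
apply: represents_ext => [h hh|x]; rewrite !mul1r // rharmonic_children //.
have := size_children_neq0 (pred z); rewrite size_children (negbTE pz) addn0 =>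
  q0.
by field.
Qed.

Lemma represents_exists z : exists k, represents (fun h => h z) k.
Proof.
have [n] := ubnP (height z); elim: n => // n IHn in z *; rewrite ltnS => hz.
have [->|zo] := eqVneq z o; first by eexists; exact: represents_origin.
have hp := height_predecessor zo.
have [k' rk'] : exists k, represents (fun h => h (pred z)) k.
  by apply: IHn; rewrite hp.
have [pz|pz] := eqVneq (pred z) o.
  by rewrite pz in rk'; eexists; exact: represents_child rk'.
have [k rk] : exists k, represents (fun h => h (pred (pred z))) k.
  by apply: IHn; rewrite (leq_trans _ hz) // -hp ltnW // height_predecessor.
by eexists; exact: represents_grandchild rk rk'.
Qed.

End Kernel.

(** * From real representing functions to the complex kernel *)

Section ComplexKernel.
Variables (R : realType) (q : nat) (X : homogeneousTree q) (o : X).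
Hypothesis q_gt1 : (1 < q)%N.
Variable sigma : X -> R.
Hypothesis sigmaP : reference_measure o sigma.
Notation ball_summable := (ball_summable o).
Notation Re := (@complex.Re R).
Notation Im := (@complex.Im R).
Implicit Types (f g : X -> R[i]).

Let sigma_gt0 : forall x, 0 < sigma x := refm_gt0 sigmaP.

Lemma complex_ext (a b : R[i]) : Re a = Re b -> Im a = Im b -> a = b.
Proof. by case: a b => [? ?] [? ?] /= -> ->. Qed.

Lemma Re_realM (c : R) (a : R[i]) : Re (c%:C%C * a) = c * Re a.
Proof. by case: a => a b /=; rewrite mul0r subr0. Qed.

Lemma Im_realM (c : R) (a : R[i]) : Im (c%:C%C * a) = c * Im a.
Proof. by case: a => a b /=; rewrite mul0r addr0. Qed.

Lemma Re_sum (I : Type) (r : seq I) (F : I -> R[i]) :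
  Re (\sum_(i <- r) F i) = \sum_(i <- r) Re (F i).
Proof.
elim: r => [|i r IHr]; rewrite ?big_nil // !big_cons -IHr.
by case: (F i) (\sum_(j <- r) F j) => [? ?] [? ?].
Qed.

Lemma Im_sum (I : Type) (r : seq I) (F : I -> R[i]) :
  Im (\sum_(i <- r) F i) = \sum_(i <- r) Im (F i).
Proof.
elim: r => [|i r IHr]; rewrite ?big_nil // !big_cons -IHr.
by case: (F i) (\sum_(j <- r) F j) => [? ?] [? ?].
Qed.

Lemma harmonic_funP f :
  harmonic_fun f <-> rharmonic (Re \o f) /\ rharmonic (Im \o f).
Proof.
have fsE v : \sum_(u \in neighbours v) f u = \sum_(u <- fset_set (neighbours v))
  f u.
  by rewrite fsbig_finite //; exact: finite_neighbours.
have nE n : n%:R = (n%:R : R)%:C%C :> R[i] by rewrite rmorph_nat.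
have q0 : q.+1%:R != 0 :> R[i] by rewrite pnatr_eq0.
split=> [hf|[hr hi] v _].
  have {}hf v : q.+1%:R * f v = \sum_(u <- fset_set (neighbours v)) f u.
    by rewrite (hf v) // fsE mulVKf.
  split=> v; first by rewrite -Re_sum -hf nE Re_realM.
  by rewrite -Im_sum -hf nE Im_realM.
apply: (mulfI q0); rewrite mulVKf // fsE nE.
apply: complex_ext; first by rewrite Re_realM Re_sum; exact: hr.
by rewrite Im_realM Im_sum; exact: hi.
Qed.

Lemma normc_sqr (a : R[i]) : ComplexField.Normc.normc a ^+ 2 = Re a ^+ 2 + Im a
  ^+ 2.
Proof. by case: a => a b /=; rewrite sqr_sqrtr // addr_ge0 ?sqr_ge0. Qed.

Lemma A2P f : A2 sigma f <-> [/\ rharmonic (Re \o f), rharmonic (Im \o f)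
  & ball_summable (fun x => (Re (f x) ^+ 2 + Im (f x) ^+ 2) * sigma x)].
Proof.
have F0 x : 0 <= (Re (f x) ^+ 2 + Im (f x) ^+ 2) * sigma x.
  by rewrite mulr_ge0 ?(ltW (sigma_gt0 x)) // addr_ge0 ?sqr_ge0.
have -> : A2 sigma f <-> harmonic_fun f /\
    ball_summable (fun x => (Re (f x) ^+ 2 + Im (f x) ^+ 2) * sigma x).
  rewrite ball_summableP //; under eq_esum => x _ do rewrite -normc_sqr.
  by [].
rewrite harmonic_funP; split=> [[[? ?] ?]|[? ? ?]]; by split.
Qed.

(** Square-integrable functions are integrable since sigma has finite mass:
    |u| <= u^2 + 1. *)
Lemma ball_summable_sqr (u : X -> R) :
  ball_summable (fun x => u x ^+ 2 * sigma x) ->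
  ball_summable (fun x => u x * sigma x).
Proof.
move=> su; have := ball_summable_lin 1 1 su (ball_summable_sigma sigmaP).
apply: ball_summable_le => x; have s0 := ltW (sigma_gt0 x).
rewrite !mul1r normrM (ger0_norm s0) -[X in _ + X]mul1r -mulrDl ler_wpM2r //.
rewrite -real_normK ?num_real //; have := sqr_ge0 (`|u x| - 1); nra.
Qed.

Lemma A2_ball_summable f : A2 sigma f ->
  ball_summable (fun x => Re (f x) * sigma x) /\ ball_summable (fun x =>
    Im (f x) * sigma x).
Proof.
move=> /A2P[_ _ sf]; split; apply: ball_summable_sqr;
  apply: ball_summable_le sf => x;
  have s0 := ltW (sigma_gt0 x);
  rewrite normrM (ger0_norm s0) ler_wpM2r // ger0_norm ?sqr_ge0 //.
  by rewrite lerDl sqr_ge0.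
by rewrite lerDr sqr_ge0.
Qed.

Lemma A2_real k M : rharmonic k -> (forall x, `|k x| <= M) ->
  A2 sigma (fun x => (k x)%:C%C).
Proof.
move=> hk kM; apply/A2P; split=> //; first by exact: rharmonic_cst.
apply: (@ball_summable_le _ _ _ _ (fun x => M ^+ 2 * sigma x + 0 * sigma x));
  last first.
  exact: ball_summable_lin (ball_summable_sigma sigmaP) (ball_summable_sigma
    sigmaP).
move=> x; have s0 := ltW (sigma_gt0 x).
rewrite mul0r addr0 normrM (ger0_norm s0) ler_wpM2r //= expr0n addr0.
by rewrite normrX lerXn2r ?nnegrE // (le_trans _ (kM x)).
Qed.

Lemma A2_sub f g : A2 sigma f -> A2 sigma g -> A2 sigma (fun x => f x - g x).
Proof.
move=> /A2P[fr fi sf] /A2P[gr gi sg]; apply/A2P.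
have ReB x : Re (f x - g x) = 1 * Re (f x) + (-1) * Re (g x).
  by case: (f x) (g x) => [? ?] [? ?] /=; rewrite mul1r mulN1r.
have ImB x : Im (f x - g x) = 1 * Im (f x) + (-1) * Im (g x).
  by case: (f x) (g x) => [? ?] [? ?] /=; rewrite mul1r mulN1r.
split.
- have -> : Re \o (fun x => f x - g x) = fun x =>
  1 * Re (f x) + (-1) * Re (g x).
    by apply/funext => x; exact: ReB.
  exact: (rharmonic_lin 1 (-1) fr gr).
- have -> : Im \o (fun x => f x - g x) = fun x =>
  1 * Im (f x) + (-1) * Im (g x).
    by apply/funext => x; exact: ImB.
  exact: (rharmonic_lin 1 (-1) fi gi).
apply: ball_summable_le (ball_summable_lin 2 2 sf sg) => x;
  have s0 := ltW (sigma_gt0 x).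
rewrite ger0_norm; last by rewrite mulr_ge0 // addr_ge0 ?sqr_ge0.
rewrite !mulrA -mulrDl ler_wpM2r // ReB ImB !mul1r !mulN1r.
set a := Re (f x); set b := Im (f x); set c := Re (g x); set d := Im (g x).
have := sqr_ge0 (a + c); have := sqr_ge0 (b + d); nra.
Qed.

Lemma A2_dotE f g : A2_dot sigma f g =
  Complex (rsum (fun x => (Re (f x) * Re (g x) + Im (f x) * Im (g x)) * sigma
    x))
          (rsum (fun x => (Im (f x) * Re (g x) - Re (f x) * Im (g x)) * sigma
            x)).
Proof.
rewrite /A2_dot /csum; congr Complex; congr rsum; apply/funext => x.
  rewrite -[_ * _%:C%C]mulrC Re_realM mulrC; congr (_ * _).
  by case: (f x) (g x) => [a b] [c d] /=; rewrite mulrN opprK.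
rewrite -[_ * _%:C%C]mulrC Im_realM mulrC; congr (_ * _).
by case: (f x) (g x) => [a b] [c d] /=; rewrite mulrN addrC.
Qed.

Lemma A2_ball_summable_mul f g : A2 sigma f -> A2 sigma g ->
  ball_summable (fun x => (Re (f x) * Re (g x) + Im (f x) * Im (g x)) * sigma
    x).
Proof.
move=> /A2P[_ _ sf] /A2P[_ _ sg]; apply: ball_summable_le (ball_summable_lin 1 1
  sf sg) => x.
have s0 := ltW (sigma_gt0 x).
rewrite !mul1r normrM (ger0_norm s0) -mulrDl ler_wpM2r //.
set a := Re (f x); set b := Im (f x); set c := Re (g x); set d := Im (g x).
rewrite ler_norml; apply/andP; split.
  have := sqr_ge0 (a + c); have := sqr_ge0 (b + d); have := sqr_ge0 a.
  by have := sqr_ge0 b; have := sqr_ge0 c; have := sqr_ge0 d; nra.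
have := sqr_ge0 (a - c); have := sqr_ge0 (b - d); have := sqr_ge0 a.
by have := sqr_ge0 b; have := sqr_ge0 c; have := sqr_ge0 d; nra.
Qed.

(** Two reproducing elements have the same product with their difference d,
    so |d|^2 sigma has sum zero; as sigma is positive, d vanishes. *)
Lemma repr_kernelE z k : represents o sigma (fun h => h z) k ->
  repr_kernel sigma z = fun x => (k x)%:C%C.
Proof.
move=> [hk [M kM] kz]; have Ak := A2_real hk kM.
have dotk g : A2 sigma g -> A2_dot sigma g (fun x => (k x)%:C%C) = g z.
  move=> Ag; have [/(kz (Re \o g)) sr /(kz (Im \o g)) si] := A2_ball_summable
    Ag.
  move/A2P: Ag => [/sr[_ rr] /si[_ ri] _]; rewrite A2_dotE /=.
  apply: complex_ext => /=.
    by rewrite -[RHS]rr; congr rsum; apply/funext => x /=; rewrite mulr0 addr0.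
  by rewrite -[RHS]ri; congr rsum; apply/funext => x /=; rewrite mulr0 subr0.
apply: xget_unique => // k' [Ak' dotk'].
(* The real part of <d, k'> = <d, k> says that |d|^2 sigma has sum zero. *)
pose d x := k' x - (k x)%:C%C.
have Ad : A2 sigma d by exact: A2_sub.
have sk' := A2_ball_summable_mul Ad Ak'; have sk := A2_ball_summable_mul Ad Ak.
have := etrans (dotk' d Ad) (esym (dotk d Ad)); rewrite !A2_dotE => -[eqr _].
pose D x := (Re (d x) ^+ 2 + Im (d x) ^+ 2) * sigma x.
have DE : D = fun x =>
    1 * ((Re (d x) * Re (k' x) + Im (d x) * Im (k' x)) * sigma x) +
    (-1) * ((Re (d x) * Re (k x)%:C%C + Im (d x) * Im (k x)%:C%C) * sigma x).
  apply/funext => x; rewrite /D /d; case: (k' x) => a b /=; ring.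
have D0 : rsum D = 0 by rewrite DE (rsum_lin _ _ sk' sk) eqr mul1r mulN1r subrr.
have Dge0 x : 0 <= D x.
  by rewrite mulr_ge0 ?(ltW (sigma_gt0 x)) // addr_ge0 ?sqr_ge0.
have sD : ball_summable D by case/A2P: Ad.
apply/funext => x; have /eqP := rsum_eq0 Dge0 sD D0 x.
rewrite mulf_eq0 (gt_eqF (sigma_gt0 x)) orbF paddr_eq0 ?sqr_ge0 // !sqrf_eq0.
move=> /andP[/eqP dr /eqP di]; apply/eqP; rewrite -subr_eq0; apply/eqP.
exact: complex_ext.
Qed.

End ComplexKernel.

(** * The functions Gamma as sphere data *)

Section Gamma.
Variables (R : realType) (q : nat) (X : homogeneousTree q) (o : X).
Notation height := (height o).
Notation pred := (predecessor o).

Lemma mem_geodesic x : x \in geodesic o x.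
Proof.
have [p [pth up <-]] := simple_path_exists o x.
by rewrite geodesic_simple // mem_last.
Qed.

(** Sectors are defined through geodesics; this translates membership into
    iterated predecessors, the form in which harmonic extensions are defined. *)
Lemma mem_geodesic_ancestor v x : v \in geodesic o x ->
  height x = (height v + (height x - height v))%N /\
  iter (height x - height v) pred x = v.
Proof.
have [n] := ubnP (height x); elim: n => // n IHn in x *; rewrite ltnS => hx.
have [->|xo] := eqVneq x o.
  by rewrite geodesic_origin inE => /eqP ->; rewrite subnn addn0.
rewrite geodesic_predecessor // mem_rcons inE => /predU1P[->|vp].
  by rewrite subnn addn0.
have hp := height_predecessor xo.
have [||e it] := IHn (pred x); [by rewrite hp | by [] |].
have le : (height v <= height (pred x))%N by rewrite e leq_addr.
by rewrite -hp subSn // iterSr it addnS -e.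
Qed.

Lemma sector_ancestor v x : sector o v x ->
  (height v <= height x)%N /\ iter (height x - height v) pred x = v.
Proof.
rewrite /sector; have [-> _|vo sub] := eqVneq v o.
  have [p [pth up <-]] := simple_path_exists o x.
  have [e it] : height (last o p) = (height o + (height (last o p) - height
    o))%N /\
    iter (height (last o p) - height o) pred (last o p) = o.
    by apply: mem_geodesic_ancestor; rewrite geodesic_simple // mem_head.
  by split; [rewrite height_origin | exact: it].
have [e it] := mem_geodesic_ancestor (sub _ (mem_geodesic v)).
by rewrite e leq_addr -e.
Qed.

Lemma sector_refl v : sector o v v.
Proof. by rewrite /sector; case: ifP => // _ x. Qed.

Lemma sector_child u : u != o -> sector o (pred u) u.
Proof.
move=> uo; rewrite /sector; case: ifP => // _ x /= xp.
by rewrite (geodesic_predecessor uo) mem_rcons inE xp orbT.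
Qed.

(** The extension of Gamma(v, z, .) subtracts a multiple of its value at an
    ancestor of height |v|; these values vanish. *)
Lemma Gamma_low v z x : (height x <= height v)%N -> Gamma R o v z x = 0.
Proof.
move=> hx; rewrite /Gamma; case: asboolP => // sub; exfalso.
have [/sector_ancestor[hv it]] := sub x (or_intror erefl); apply.
have e : height x = height v by apply/eqP; rewrite eqn_leq hx.
by rewrite -it e subnn.
Qed.

Lemma Gamma_sphere (q_gt1 : (1 < q)%N) z u : z != o -> height u = height z ->
  Gamma R o (pred z) z u = (sibling_weight R o z u)%:C%C.
Proof.
move=> zo hu; have hp := height_predecessor zo.
have uo : u != o by rewrite -(height_eq0 o) hu -hp.
have inT w : w != o -> height w = height z ->
    (sector o (pred z) `\ pred z) w <-> pred w = pred z.
  move=> wo hw; split=> [[/sector_ancestor[_]]|e].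
    by rewrite hw -hp subSnn.
  split; first by rewrite -e; exact: sector_child.
  by move=> /= we; move: hp; rewrite -we hw => /esym/n_Sn.
have eqT w y : height w = height z -> height y = height z ->
    sector o y w -> w = y.
  by move=> hw hy /sector_ancestor[_]; rewrite hw hy subnn.
rewrite /Gamma /sibling_weight uo /=; set s := num_successors o (pred z).
have -> : size (children o (pred z)) = s by [].
have s0 : s%:R != 0 :> R by exact: size_children_neq0.
have [puz|puz] := eqVneq (pred u) (pred z); last first.
  case: asboolP => // sub; case/eqP: puz.
  by apply/(inT u uo hu); apply: sub; right.
have -> : `[< [set z; u] `<=` sector o (pred z) `\ pred z >] = true.
  by apply/asboolP => w [] ->; apply/inT.
have [uz|uz] := eqVneq u z.
  have -> : `[< exists2 y, successors o (pred z) y & [set z;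
    u] `<=` sector o y >] = true.
    apply/asboolP; exists z; first exact/successorsP.
    by rewrite uz => w [] ->; exact: sector_refl.
  rewrite /= -(rmorph_nat (real_complex R)) -fmorphV -(rmorph1 (real_complex
    R)).
  by rewrite -rmorphB -rmorphM mulrBl mul1r divff.
case: asboolP => [[y /successorsP[yo py] sub]|_] /=.
  have hy : height y = height z by rewrite -hp -py height_predecessor.
  case/eqP: uz; rewrite (eqT u y) //; last by apply: sub; right.
  by rewrite (eqT z y) //; apply: sub; left.
by rewrite -(rmorph_nat (real_complex R)) -fmorphV -rmorphN sub0r.
Qed.

Lemma harmonic_extension_Gamma (q_gt1 : (1 < q)%N) z x : z != o ->
  harmonic_extension o (height z).-1 (Gamma R o (pred z) z) x =
  (radial_lift o (height z).-1 (sibling_weight R o z) x)%:C%C.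
Proof.
move=> zo; have hp := height_predecessor zo.
have hz : (height z).-1 = height (pred z) by rewrite -hp.
rewrite /harmonic_extension hz; case: leqP => hx.
  by rewrite Gamma_low // radial_lift_ball.
set j := (height x - height (pred z) - 1)%N.
have hj : (height x - height (pred z))%N = j.+1.
  by rewrite /j subn1 prednK // subn_gt0.
have hit i y : (i <= height y)%N -> height (iter i pred y) = (height y - i)%N.
  elim: i => [|i IHi] iy; first by rewrite subn0.
  have e := IHi (ltnW iy).
  have yo : iter i pred y != o by rewrite -(height_eq0 o) e -lt0n subn_gt0.
  by apply/eqP; rewrite -eqSS iterS height_predecessor // e subnS prednK //
    subn_gt0.
have hxj : height x = (height (pred z) + j.+1)%N by rewrite -hj subnKC // ltnW.
rewrite hj (Gamma_low _ (x := iter j.+1 pred x)); last first.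
  by rewrite hit hxj ?addnK // leq_addl.
rewrite mulr0 subr0 Gamma_sphere //; last first.
  by rewrite hit hxj addnS ?leqW ?leq_addl // subSn ?leq_addl // addnK hp.
by rewrite /radial_lift hj rmorphM.
Qed.

End Gamma.

(** * The recursion for the kernels *)

Theorem proposition10 (R : realType) (q : nat) (hq : (2 <= q)%N)
    (X : homogeneousTree q) (o : X) (sigma : X -> R)
    (hsigma : reference_measure o sigma) (z : X) :
  let K := repr_kernel sigma in
  let b := b_coef o sigma in
  let m := height o z in
  let v t := nth o (geodesic o z) t in
  [/\ z = o -> K z = (fun=> (B_sigma sigma)%:C%C^-1),
      m = 1%N -> K z = (fun x => K o x
        + (b 0%N)%:C%C^-1 * harmonic_extension o 0 (Gamma R o o z) x)
    & (1 < m)%N -> K z = (fun x => - q%:R^-1 * K (v (m - 2)%N) x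
        + (q.+1%:R / q%:R) * K (v (m - 1)%N) x
        + (b (m - 1)%N)%:C%C^-1
          * harmonic_extension o (m - 1) (Gamma R o (v (m - 1)%N) z) x)].
Proof.
move=> K b m v.
have natC n : n%:R = (n%:R : R)%:C%C :> R[i] by rewrite rmorph_nat.
split=> [-> | m1 | m_gt1].
- rewrite /K (repr_kernelE hsigma (represents_origin hq hsigma)).
  by apply/funext => x; rewrite fmorphV.
- have zo : z != o by rewrite -(height_eq0 o) -/m m1.
  have pz : predecessor o z = o.
    by apply/eqP; rewrite -(height_eq0 o) -eqSS height_predecessor // -/m m1.
  have ro := represents_origin hq hsigma.
  rewrite /K (repr_kernelE hsigma (represents_child hq hsigma zo pz ro)).
  rewrite (repr_kernelE hsigma ro); apply/funext => x.
  have := harmonic_extension_Gamma R hq x zo.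
  by rewrite -/m m1 pz /= => ->; rewrite rmorphD rmorphM /= !fmorphV.
have zo : z != o by rewrite -(height_eq0 o) -lt0n ltnW.
have hp := height_predecessor zo.
have pzo : predecessor o z != o by rewrite -(height_eq0 o) -lt0n -ltnS hp.
have hpp := height_predecessor pzo.
have nth_geodesic y : nth o (geodesic o y) (height o y) = y.
  have [p [pth up <-]] := simple_path_exists o y.
  rewrite geodesic_simple // /Defs.height dist_simple //.
  by rewrite -[size p]/((size (o :: p)).-1) nth_last.
have v1 : v (m - 1)%N = predecessor o z.
  rewrite /v /m -hp subn1 geodesic_predecessor // nth_rcons -height_geodesic
    leqnn.
  exact: nth_geodesic.
have v2 : v (m - 2)%N = predecessor o (predecessor o z).
  rewrite /v /m -hp -hpp subn2 geodesic_predecessor // nth_rcons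
    -height_geodesic.
  rewrite -hpp ltnS leqnSn geodesic_predecessor // nth_rcons -height_geodesic
    leqnn.
  exact: nth_geodesic.
have [k rk] := represents_exists hq hsigma (predecessor o (predecessor o z)).
have [k' rk'] := represents_exists hq hsigma (predecessor o z).
rewrite v1 v2 /K (repr_kernelE hsigma rk) (repr_kernelE hsigma rk').
rewrite (repr_kernelE hsigma (represents_grandchild hq hsigma zo pzo rk rk')).
apply/funext => x; rewrite /m subn1 harmonic_extension_Gamma // !natC.
by rewrite !rmorphD !rmorphM rmorphN /= !fmorphV.
Qed.
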